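(* If $T$ is a tree, then ${\rm pind}(A_{R(T)})=1$ and hence $R(T)$ is $(2,2)$-choosable.
   Context: Graphs are finite and simple. For a connected graph $G$, $R(G)$ is the graph obtained from $G$ by adding $|E(G)|$ new vertices, one for each edge of $G$, and joining each new vertex to the two endvertices of its corresponding edge (the edges of $G$ are kept). The permanent of an $m\times m$ real matrix $A=[a_{ij}]$ is ${\rm per}(A)=\sum_{\sigma}\prod_{i=1}^{m}a_{i\sigma(i)}$, summed over all permutations $\sigma$ of $\{1,\ldots,m\}$. The permanent index ${\rm pind}(A)$ of a matrix $A$ with $m$ rows is the minimum integer $k$ such that there is an $m\times m$ matrix $A'$ with ${\rm per}(A')\neq 0$, each column of which is a column of $A$, and such that each column of $A$ occurs in $A'$ at most $k$ times. For a graph $G$, fix an orientation of its edges. $A_G$ is the matrix with rows indexed by the edges of $G$ and columns indexed by the vertices and edges of $G$, where for $e=(u,v)$ (oriented from $u$ to $v$), $A_G[e,y]=1$ if $y=v$ or $y\neq e$ is an edge incident to $v$; $A_G[e,y]=-1$ if $y=u$ or $y\neq e$ is an edge incident to $u$; and $A_G[e,y]=0$ otherwise. (Reversing an edge multiplies the corresponding row by $-1$, so ${\rm pind}(A_G)$ does not depend on the orientation.) A total-weighting of $G=(V,E)$ is a mapping $f:V\cup E\to\mathbb{R}$. For $v\in V$ put $s(v)=f(v)+\sum_{e\in E(v)}f(e)$, where $E(v)$ is the set of edges incident with $v$. The total-weighting $f$ is proper if $s(u)\neq s(v)$ for any two adjacent vertices $u,v$. The graph $G$ is $(k,k')$-choosable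 if for every assignment $L$ of a set $L(v)$ of $k$ real numbers to each vertex $v$ and a set $L(e)$ of $k'$ real numbers to each edge $e$, there is a proper total-weighting $f$ with $f(z)\in L(z)$ for all $z\in V\cup E$.
   Formalization: The equality pind(A_{R(T)})=1 is stated for trees with at least two vertices: for the one-vertex tree R(T) has no edges, the matrix has no rows, and its permanent index is 0. The (2,2)-choosability of R(T) is stated for all trees. *)

(* Defs.v *)
From HB Require Import structures.
From mathcomp Require Import all_boot all_order all_algebra all_fingroup.
From mathcomp Require Import finmap.
From mathcomp Require Import reals.

Set Implicit Arguments.
Unset Strict Implicit.
Unset Printing Implicit Defensive.

Import Order.TTheory GRing.Theory Num.Theory.
Local Open Scope ring_scope.

Record sgraph := SGraph {
  vertex :> finType;
  adj : rel vertex;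
  adj_sym : symmetric adj;
  adj_irrefl : irreflexive adj
}.

Definition edges (G : sgraph) : {set {set G}} :=
  [set [set p.1; p.2] | p : G * G & adj p.1 p.2].

Definition edge (G : sgraph) : finType := {e : {set G} | e \in edges G}.

Definition incident (G : sgraph) (v : G) (e : edge G) : bool := v \in val e.

Definition connected_graph (G : sgraph) : Prop :=
  (0 < #|G|)%N /\ forall x y : G, connect (@adj G) x y.

(* A cycle is a duplicate-free cyclic sequence of at least three vertices;
   [ucycle] alone also accepts an edge traversed back and forth. *)
Definition acyclic (G : sgraph) : Prop :=
  forall c : seq G, (2 < size c)%N -> ~ ucycle (@adj G) c.

Definition tree (G : sgraph) : Prop := connected_graph G /\ acyclic G.

Section RGraph.
Variable G : sgraph.

Definition Radj : rel (G + edge G)%type := fun a b =>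
  match a, b with
  | inl x, inl y => adj x y
  | inl x, inr e => incident x e
  | inr e, inl x => incident x e
  | inr _, inr _ => false
  end.

Lemma Radj_sym : symmetric Radj.
Proof. by case=> [x|e] [y|f] //=; apply: adj_sym. Qed.

Lemma Radj_irrefl : irreflexive Radj.
Proof. by case=> [x|e] //=; apply: adj_irrefl. Qed.

Definition Rgraph : sgraph :=
  @SGraph (G + edge G)%type Radj Radj_sym Radj_irrefl.

End RGraph.

Record orientation (G : sgraph) := Orientation {
  tail : edge G -> G;
  head : edge G -> G;
  orientationP : forall e : edge G, val e = [set tail e; head e]
}.

Lemma orientation_exists (G : sgraph) : inhabited (orientation G).
Proof.
have ends (e : edge G) : {p : G * G | val e == [set p.1; p.2]}.
  apply: sigW; case/imsetP: (valP e) => p _ ep.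
  by exists p; apply/eqP.
by exists; apply: (@Orientation G (fun e => (sval (ends e)).1)
  (fun e => (sval (ends e)).2)) => e; apply/eqP; apply: (svalP (ends e)).
Qed.

Section Permanent.
Variable R : realType.

Definition per m (A : 'M[R]_m) : R :=
  \sum_(s : 'S_m) \prod_(i < m) A i (s i).

(* The matrix A' is [colsub phi A], where [phi] selects the columns by their
   index: equal columns of A with different indices are counted separately. *)
Definition pind_at_most m n (A : 'M[R]_(m, n)) (k : nat) : Prop :=
  exists phi : 'I_m -> 'I_n,
    per (colsub phi A) != 0 /\
    forall j : 'I_n, (#|[set i | phi i == j]| <= k)%N.

(* [pind A = k]; it is a relation since no such k exists when every choice
   of columns gives permanent 0. *)
Definition is_pind m n (A : 'M[R]_(m, n)) (k : nat) : Prop :=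
  pind_at_most A k /\ forall l : nat, pind_at_most A l -> (k <= l)%N.

Variables (G : sgraph) (D : orientation G).

Definition A_entry (e : edge G) (y : G + edge G) : R :=
  match y with
  | inl w => if w == head D e then 1 else if w == tail D e then -1 else 0
  | inr e' =>
      if (e' != e) && incident (head D e) e' then 1
      else if (e' != e) && incident (tail D e) e' then -1 else 0
  end.

Definition A_mx : 'M[R]_(#|edge G|, #|{: G + edge G}|) :=
  \matrix_(i, j) A_entry (enum_val i) (enum_val j).

End Permanent.

Section TotalWeighting.
Variables (R : realType) (G : sgraph).

Definition weight_sum (f : G + edge G -> R) (v : G) : R :=
  f (inl v) + \sum_(e : edge G | incident v e) f (inr e).

Definition proper_weighting (f : G + edge G -> R) : Prop :=
  forall u v : G, adj u v -> weight_sum f u <> weight_sum f v.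

Definition choosable (k k' : nat) : Prop :=
  forall L : G + edge G -> {fset R},
    (forall v : G, #|` L (inl v)| = k) ->
    (forall e : edge G, #|` L (inr e)| = k') ->
    exists f : G + edge G -> R,
      proper_weighting f /\ forall z, f z \in L z.

End TotalWeighting.

(* Main.v *)
Require Import Defs.
From mathcomp Require Import all_boot all_algebra reals.
From mathcomp Require Import all_fingroup finmap ring.

Set Implicit Arguments.
Unset Strict Implicit.
Unset Printing Implicit Defensive.

Import GRing.Theory Num.Theory.
Local Open Scope ring_scope.

(** Let H be the graph R(T), and let y_w stand for the vertex sum s(w).  A
    weighting of H is proper exactly when the polynomial
      P(y) = \prod_h (y_(head h) - y_(tail h)),
    over the edges h of H, does not vanish.  Both claims come from one fact
    about P: the weight variables of a suitable set Z of |E(H)| vertices and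
    edges of H are such that the iterated finite difference of P with respect
    to these variables is a nonzero constant, for all nonzero step lengths.

    The set Z consists of all vertices of T but one root, all the new
    vertices, and all the original edges of T.  To prove the fact, grow T leaf
    by leaf.  A leaf v, joined to u by the edge e, multiplies P by
    (v - u)(e - u)(e - v) and adds to Z the vertex v, the new vertex e and
    the edge uv.  Differencing this cubic in v and e leaves a multiple of
    2(e - v) plus a constant.  Moving along the edge uv then translates the
    old polynomial, which is harmless because its iterated difference is
    constant, and shifts v but not e.  So the iterated difference of P is
    multiplied by -2 times the product of the three step lengths: this is
    [difference_leaf], which [growth_difference] iterates.

    With unit steps from the origin the iterated difference is Ryser's
    alternating sum, that is, the permanent of the columns of A_H indexed by
    Z ([difference_prod_per]); as these columns have distinct indices, the
    permanent index is 1.  With steps going from one element of each list to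
    the other, a nonzero alternating sum has a nonzero term, and this term is a
    proper weighting taken from the lists ([choosable_of_difference]). *)

(** * Iterated finite differences *)

Section Difference.
Variables (V : zmodType) (R : comNzRingType).
Implicit Types (F g : V -> R) (d y t : V) (ds : seq V).

Fixpoint difference ds F y : R :=
  if ds is d :: ds' then difference ds' F (y + d) - difference ds' F y
  else F y.

Lemma eq_difference ds F F' y : F =1 F' -> difference ds F y = difference ds F' y.
Proof. by move=> eF; elim: ds y => [|d ds IH] y //=; rewrite !IH. Qed.

Lemma difference_cat ds ds' F y :
  difference (ds ++ ds') F y = difference ds (difference ds' F) y.
Proof. by elim: ds y => [|d ds IH] y //=; rewrite !IH. Qed.

Lemma difference_sub ds F F' y :
  difference ds (fun x => F x - F' x) y = difference ds F y - difference ds F' y.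
Proof. by elim: ds y => [|d ds IH] y //=; rewrite !IH; ring. Qed.

Lemma difference_sum (I : finType) ds (F : I -> V -> R) y :
  difference ds (fun x => \sum_i F i x) y = \sum_i difference ds (F i) y.
Proof. by elim: ds y => [|d ds IH] y //=; rewrite !IH -sumrB. Qed.

Lemma difference_shift ds F t y :
  difference ds (fun x => F (x + t)) y = difference ds F (y + t).
Proof. by elim: ds y => [|d ds IH] y //=; rewrite !IH addrAC. Qed.

(** A factor that does not change along the directions behaves as a scalar. *)
Lemma difference_mulr ds F g y :
  (forall d, d \in ds -> forall x, g (x + d) = g x) ->
  difference ds (fun x => F x * g x) y = difference ds F y * g y.
Proof.
elim: ds y => [|d ds IH] y //= inv_g.
rewrite !IH; try by move=> d' d'ds; apply: inv_g; rewrite inE d'ds orbT.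
by rewrite inv_g ?mem_head // mulrBl.
Qed.

(** Difference operators commute, so the direction that leaves [F] invariant
    can be taken as the innermost one, and it produces the zero function. *)
Lemma difference_eq0 ds F d y :
  d \in ds -> (forall x, F (x + d) = F x) -> difference ds F y = 0.
Proof.
move=> + inv_F; elim: ds y => [|d' ds IH] y //=.
rewrite inE => /orP[/eqP <-|d_ds]; last by rewrite !IH // subrr.
rewrite -(difference_shift ds F d y) -difference_sub.
elim: ds y {IH} => [|d'' ds IH] y /=; first by rewrite inv_F subrr.
by rewrite !IH subrr.
Qed.

(** The iterated difference is a signed sum of values of [F] at [y] plus
    partial sums of the directions; one of these values has to be nonzero. *)
Lemma difference_neq0 ds F y :
  difference ds F y != 0 ->
  exists m : bitseq, F (y + \sum_(d <- mask m ds) d) != 0.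
Proof.
elim: ds y => [|d ds IH] y /=; first by exists [::]; rewrite big_nil addr0.
have [->|/IH[m Fm] _] := eqVneq (difference ds F (y + d)) 0.
  by rewrite sub0r oppr_eq0 => /IH[m Fm]; exists (false :: m).
by exists (true :: m); rewrite /= big_cons addrA.
Qed.

End Difference.

Lemma difference_map (V W : zmodType) (R : comNzRingType) (phi : V -> W)
    (ds : seq V) (F : W -> R) y :
  {morph phi : x y / x + y} ->
  difference (map phi ds) F (phi y) = difference ds (F \o phi) y.
Proof. by move=> phiD; elim: ds y => [|d ds IH] y //=; rewrite -phiD !IH. Qed.

(** * Ryser's formula *)

Section Ryser.
Variable R : comNzRingType.

Let delta m (j : 'I_m) : {ffun 'I_m -> R} := [ffun i => (i == j)%:R].

(** The monomial is a product of functions of separate coordinates, and each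
    of them increases by 1 along its own direction. *)
Lemma difference_monomial m (js : seq 'I_m) (y : {ffun 'I_m -> R}) :
  uniq js ->
  difference (map (@delta m) js) (fun x => \prod_(j <- js) x j) y = 1.
Proof.
elim: js y => [|j js IH] y /=; first by rewrite big_nil.
case/andP=> j_js /IH{}IH.
have head_inv d : d \in map (@delta m) js ->
    forall x : {ffun 'I_m -> R}, (x + d) j = x j.
  case/mapP=> i i_js -> x; rewrite !ffunE (_ : (j == i) = false) ?addr0 //.
  by apply: contraNF j_js => /eqP->.
have E x : difference (map (@delta m) js)
    (fun x : {ffun 'I_m -> R} => \prod_(i <- j :: js) x i) x = x j.
    rewrite (@eq_difference _ _ _ _
      (fun z : {ffun 'I_m -> R} => (\prod_(i <- js) z i) * z j)) => [|z].
    by rewrite difference_mulr // IH mul1r.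
  by rewrite big_cons mulrC.
by rewrite !E !ffunE eqxx addrC addKr.
Qed.

(** Ryser's formula for the permanent: the left-hand side unfolds to the
    alternating sum, over the sets S of columns, of the product of the row sums
    over S.  Pull the directions back to the coordinate directions and expand
    the product over all choices [f] of one column per row.  If [f] misses a
    column [j], its monomial does not depend on coordinate [j], so its
    difference vanishes; otherwise [f] is a permutation and its monomial has
    difference 1. *)
Lemma difference_prod_per m (A : 'M[R]_m) :
  difference [seq [ffun i => A i j] | j <- enum 'I_m]
    (fun y : {ffun 'I_m -> R} => \prod_i y i) 0 =
  \sum_(s : 'S_m) \prod_i A i (s i).
Proof.
pose phi (t : {ffun 'I_m -> R}) : {ffun 'I_m -> R} :=
  [ffun i => \sum_j A i j * t j].
have phiD : {morph phi : x y / x + y}.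
  move=> x y; apply/ffunP=> i; rewrite !ffunE -big_split /=.
  by apply: eq_bigr => j _; rewrite ffunE mulrDr.
have phi0 : phi 0 = 0.
  by apply/ffunP=> i; rewrite !ffunE big1 // => j _; rewrite ffunE mulr0.
have -> : [seq [ffun i => A i j] | j <- enum 'I_m] =
          map phi (map (@delta m) (enum 'I_m)).
  rewrite -map_comp; apply: eq_map => j /=; apply/ffunP=> i; rewrite !ffunE.
  rewrite (bigD1 j) //= ffunE eqxx mulr1 big1 ?addr0 // => k kj.
  by rewrite ffunE (negPf kj) mulr0.
rewrite -phi0 difference_map //.
rewrite (@eq_difference _ _ _ _ (fun t : {ffun 'I_m -> R} =>
   \sum_(f : {ffun 'I_m -> 'I_m}) (\prod_i t (f i)) * \prod_i A i (f i))); last first.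
  move=> t /=; under eq_bigr => i _ do rewrite ffunE.
  rewrite bigA_distr_bigA; apply: eq_bigr => f _.
  by rewrite big_split mulrC.
rewrite difference_sum.
under eq_bigr => f _ do rewrite difference_mulr //.
rewrite (bigID (fun f : {ffun 'I_m -> 'I_m} => injectiveb f)) /=.
rewrite [X in _ + X]big1 ?addr0; last first.
  move=> f /injectiveP f_ninj.
  have [j j_f] : exists j, j \notin codom f.
    apply/existsP; apply: contra_notT f_ninj.
    rewrite negb_exists => /forallP f_surj i k fik.
    have /image_injP f_inj : #|image f 'I_m| == #|'I_m|.
      by apply/eqP/eq_card => j; rewrite [RHS]inE; apply/negPn/f_surj.
    exact: f_inj.
  rewrite (@difference_eq0 _ _ _ _ (delta j)) ?mul0r //.
    by rewrite map_f // mem_enum.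
  move=> x; apply: eq_bigr => i _; rewrite !ffunE.
  rewrite (_ : (f i == j) = false) ?addr0 //.
  by apply: contraNF j_f => /eqP <-; apply: codom_f.
rewrite (reindex (fun s : 'S_m => pval s)) /=; last first.
  exists (insubd (1%g : 'S_m)) => /= f f_inj; first exact/val_inj/insubdK.
  exact: insubdK.
apply: eq_big => [s|s _]; first exact: (valP s).
rewrite (@eq_difference _ _ _ _ (fun x : {ffun 'I_m -> R} => \prod_(j <- enum 'I_m) x j)).
  by rewrite difference_monomial ?enum_uniq // mul1r; apply: eq_bigr => i _; rewrite pvalE.
move=> x; rewrite big_enum /= [RHS](reindex_inj (@perm_inj _ s)) /=.
by apply: eq_bigr => i _; rewrite pvalE.
Qed.
End Ryser.
(** * Edges and orientations *)

Section Edges.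
Variable G : sgraph.

Lemma adj_in_edges (u v : G) : adj u v -> [set u; v] \in edges G.
Proof. by move=> uv; apply/imsetP; exists (u, v); rewrite ?inE. Qed.

Definition mk_edge (u v : G) (uv : adj u v) : edge G :=
  Sub [set u; v] (adj_in_edges uv).

Lemma set2_eqP (T : finType) (a b c d : T) :
  [set a; b] = [set c; d] -> (a = c /\ b = d) \/ (a = d /\ b = c).
Proof.
move=> E.
have : a \in [set c; d] by rewrite -E set21.
have : b \in [set c; d] by rewrite -E set22.
have : c \in [set a; b] by rewrite E set21.
have : d \in [set a; b] by rewrite E set22.
by do 4![case/set2P=> ?]; subst; auto.
Qed.

Lemma edge_ends (e : edge G) : exists u v : G, adj u v /\ val e = [set u; v].
Proof. by case/imsetP: (valP e) => -[u v]; rewrite inE => uv ->; exists u, v. Qed.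

Lemma incidentE (e : edge G) (u v x : G) :
  val e = [set u; v] -> incident x e = (x == u) || (x == v).
Proof. by rewrite /incident => ->; rewrite !inE. Qed.

Lemma edge_adj (e : edge G) (u v : G) : val e = [set u; v] -> adj u v.
Proof.
have [x [y [xy ->]]] := edge_ends e.
by move/set2_eqP => [] [<- <-] //; rewrite adj_sym.
Qed.

Lemma edge_neq (e : edge G) (u v : G) : val e = [set u; v] -> u != v.
Proof. by move/edge_adj; apply: contraTneq => ->; rewrite adj_irrefl. Qed.

Lemma edge_set2 (f : edge G) (u v : G) :
  incident u f -> incident v f -> u != v -> val f = [set u; v].
Proof.
have [x [y [_ fE]]] := edge_ends f; rewrite !(incidentE _ fE) fE.
by do 2![case/orP=> /eqP->]; rewrite ?eqxx // setUC.
Qed.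

Variable O : orientation G.

Lemma adj_ends e : adj (tail O e) (Defs.head O e).
Proof. exact: edge_adj (orientationP O e). Qed.

Lemma incident_tail e : incident (tail O e) e.
Proof. by rewrite (incidentE _ (orientationP O e)) eqxx. Qed.

Lemma incident_head e : incident (Defs.head O e) e.
Proof. by rewrite (incidentE _ (orientationP O e)) eqxx orbT. Qed.

End Edges.

(** * Growing a tree leaf by leaf *)

Section Growth.
Variable G : sgraph.

(** A record of how a set of vertices and a set of edges are reached from a
    root by hanging one new vertex at a time.  Only the hanging edge is
    mentioned, so this makes sense in any graph; acyclicity enters in
    [growth_complete]. *)
Inductive growth : seq G -> seq (edge G) -> Prop :=
| growth_root r : growth [:: r] [::]
| growth_leaf s es u v e : growth s es -> u \in s -> v \notin s ->
    val e = [set u; v] -> growth (v :: s) (e :: es).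

Lemma growth_uniq s es : growth s es -> uniq s.
Proof. by elim=> //= {}s es' u v e _ -> _ ->. Qed.

Lemma growth_size s es : growth s es -> size s = (size es).+1.
Proof. by elim=> //= {}s es' u v e _ -> _ _. Qed.

Lemma growth_incident s es : growth s es ->
  forall e x, e \in es -> incident x e -> x \in s.
Proof.
elim=> //= {}s {}es u v e _ IH us vs eE f x; rewrite !inE.
case/orP=> [/eqP-> | fes] xf; last by rewrite (IH f) ?orbT.
by move: xf; rewrite (incidentE _ eE) => /orP[]/eqP->; rewrite ?us ?eqxx ?orbT.
Qed.

Lemma growth_uniq_edges s es : growth s es -> uniq es.
Proof.
elim=> //= {}s {}es u v e gr -> us vs eE; rewrite andbT.
apply: contra vs => ees; apply: (growth_incident gr ees).
by rewrite (incidentE _ eE) eqxx orbT.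
Qed.

Lemma growth_path s es : growth s es -> forall x y, x \in s -> y \in s ->
  exists p, [/\ path (@adj G) x p, last x p = y & {subset p <= s}].
Proof.
elim=> [r|{}s {}es u v e gr IH us vs eE] x y.
  by rewrite !inE => /eqP-> /eqP->; exists [::].
have uv := edge_adj eE.
have sub p : {subset p <= s} -> {subset p <= v :: s}.
  by move=> ps z /ps zs; rewrite inE zs orbT.
rewrite !inE => /orP[/eqP->|xs] /orP[/eqP->|ys].
- by exists [::].
- have [p [pp lp ps]] := IH u y us ys; exists (u :: p).
  split=> //=; first by rewrite adj_sym uv.
  by apply: sub => z; rewrite inE => /orP[/eqP->|/ps].
- have [p [pp lp ps]] := IH x u xs us; exists (rcons p v).
  rewrite rcons_path last_rcons pp lp; split=> //.
  by move=> z; rewrite mem_rcons !inE => /orP[->|/ps ->]; rewrite ?orbT.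
- by have [p [pp lp ps]] := IH x y xs ys; exists p; split=> //; apply: sub.
Qed.

(** An edge from the new vertex [v] to an old vertex [w] other than [u] would
    close a cycle with [v u] and a path from [u] to [w] among old vertices. *)
Lemma growth_complete s es : acyclic G -> growth s es ->
  forall f : edge G, (forall x, incident x f -> x \in s) -> f \in es.
Proof.
move=> acG; elim=> [r|{}s {}es u v e gr IH us vs eE] f fs.
  have [x [y [xy fE]]] := edge_ends f.
  have /fs : incident x f by rewrite (incidentE _ fE) eqxx ?orbT.
  have /fs : incident y f by rewrite (incidentE _ fE) eqxx ?orbT.
  by rewrite !inE => /eqP yr /eqP xr; move: xy; rewrite xr yr adj_irrefl.
have [vf|vf] := boolP (incident v f); last first.
  rewrite inE IH ?orbT // => x xf.
  have := fs x xf; rewrite inE => /orP[/eqP xv|//].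
  by move: vf; rewrite -xv xf.
have [w fE] : exists w, val f = [set v; w].
  have [x [y [_ fE]]] := edge_ends f.
  move: vf; rewrite (incidentE _ fE) => /orP[]/eqP->; first by exists y.
  by exists x; rewrite setUC.
have vw := edge_adj fE; have wv := edge_neq fE.
have ws : w \in s.
  have /fs : incident w f by rewrite (incidentE _ fE) eqxx ?orbT.
  by rewrite inE eq_sym (negPf wv).
have [uw|uw] := eqVneq u w.
  rewrite inE; apply/orP; left; apply/eqP/val_inj.
  by rewrite fE eE uw setUC.
have [p [pp lp ps]] := growth_path gr us ws.
case: (shortenP pp) lp => q qq uq qp lq.
case: (acG (v :: u :: q)).
  by case: q qq uq qp lq => //= _ _ _ E; rewrite E eqxx in uw.
apply/andP; split.
  by rewrite /= rcons_path qq lq adj_sym (edge_adj eE) /= adj_sym.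
rewrite cons_uniq uq andbT; apply: contra vs.
rewrite inE => /orP[/eqP->//|/qp/ps].
by [].
Qed.

(** As long as some vertex is missing, a path leading to it leaves the set of
    reached vertices by an edge, and that edge can be hung. *)
Lemma growth_exists : connected_graph G ->
  exists s es, growth s es /\ forall x, x \in s.
Proof.
case=> G_gt0 conn; have /card_gt0P[r _] := G_gt0.
have gr n : (n < #|G|)%N -> exists s es, growth s es /\ size s = n.+1.
  elim: n => [_|n IH nG]; first by exists [:: r], [::]; split=> //; constructor.
  have [s [es [gr ss]]] := IH (ltnW nG).
  have [x xs] : exists x, x \in s.
    by case: s ss {gr} => // x s; exists x; rewrite mem_head.
  have [y ys] : exists y, y \notin s.
    apply/existsP; apply: contraTT nG; rewrite negb_exists -leqNgt => /forallP sG.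
    rewrite -ss -(card_uniqP (growth_uniq gr)); apply/subset_leq_card/subsetP=> z _.
    exact/negPn/sG.
  have /connectP[p pp lp] := conn x y.
  have [u [v [us vs uv]]] : exists u v, [/\ u \in s, v \notin s & adj u v].
    elim: p x xs pp lp => [|z p IHp] x xs /=; first by move=> _ E; rewrite E xs in ys.
    case/andP=> xz pp lp; have [zs|zs] := boolP (z \in s); first exact: IHp zs pp lp.
    by exists x, z.
  exists (v :: s), (mk_edge uv :: es); split; last by rewrite /= ss.
  exact: (growth_leaf gr us vs).
have [s [es [gr_s ss]]] : exists s es, growth s es /\ size s = #|G|.
  by rewrite -(prednK G_gt0); apply: gr; rewrite prednK.
exists s, es; split=> // x.
have sG : #|s| = #|G| by rewrite (card_uniqP (growth_uniq gr_s)).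
by rewrite (subset_cardP sG (subset_predT _)).
Qed.

End Growth.
(** * The effect of one leaf *)

Section Leaf.
Variables (R : comNzRingType) (W : finType).
Implicit Types (x y d : {ffun W -> R}).

(** The heart of the proof.  Here [P] is the product over the old edges, and
    its iterated difference along the old directions [ds] is constant; [d1],
    [d2], [d3] are the directions of the vertex [v], the new vertex [e] and the
    edge [uv].  The factor of the new triangle is cubic and antisymmetric, so
    using [v], [e] and [ve] instead would give 0; the edge [uv], which also
    moves [u] in [P], is a better choice because the translation it causes in
    [P] is invisible to the old differences. *)
Lemma difference_leaf (P : {ffun W -> R} -> R) ds K eps (u v e : W)
    d1 d2 d3 c1 c2 c3 y :
  (forall y, difference ds P y = K) ->
  {in ds, forall d, d v = 0 /\ d e = 0} ->
  (forall x, P (x + d1) = P x) -> (forall x, P (x + d2) = P x) ->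
  [/\ d1 u = 0, d1 v = c1 & d1 e = 0] ->
  [/\ d2 u = 0, d2 v = 0 & d2 e = c2] ->
  [/\ d3 u = c3, d3 v = c3 & d3 e = 0] ->
  difference (ds ++ [:: d3; d2; d1])
    (fun x => P x * (eps * ((x v - x u) * (x e - x u) * (x e - x v)))) y =
  K * (eps * (- 2%:R * c1 * c2 * c3)).
Proof.
move=> PK ds0 P1 P2 [d1u d1v d1e] [d2u d2v d2e] [d3u d3v d3e].
(* The triangle factor after differencing along d1 and d2. *)
pose k x : R := eps * (c1 * c2 * (2%:R * (x e - x v) + c2 - c1)).
have k_inv d : d \in ds -> forall x, k (x + d) = k x.
  by move=> /ds0[dv de] x; rewrite /k !ffunE dv de !addr0.
rewrite difference_cat /=.
rewrite (@eq_difference _ _ _ _ (fun x =>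
    P (x + d3) * (k x - 2%:R * eps * c1 * c2 * c3) - P x * k x)); last first.
  move=> x; rewrite !P1 !P2 /k !ffunE d1u d1v d1e d2u d2v d2e d3u d3v d3e.
  by ring.
rewrite difference_sub difference_mulr => [|d dds x]; last by rewrite k_inv.
by rewrite difference_mulr // difference_shift !PK; ring.
Qed.

End Leaf.

(** * Weight directions and edge forms *)

Section Directions.
Variables (R : comNzRingType) (G : sgraph).

Definition contributes (z : G + edge G) (w : G) : bool :=
  match z with inl x => x == w | inr e => incident w e end.

(** The change of all the vertex sums when the weight of [z] grows by [c z]. *)
Definition step (c : G + edge G -> R) (z : G + edge G) : {ffun G -> R} :=
  [ffun w => c z *+ contributes z w].

Variable D : orientation G.

Definition edge_form (h : edge G) (y : {ffun G -> R}) : R :=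
  y (Defs.head D h) - y (tail D h).

Lemma edge_formD h y y' : edge_form h (y + y') = edge_form h y + edge_form h y'.
Proof. by rewrite /edge_form !ffunE; ring. Qed.

Lemma edge_formE (h : edge G) p q : val h = [set p; q] ->
  exists2 eps : R, eps != 0 & forall y, edge_form h y = eps * (y p - y q).
Proof.
rewrite (orientationP D) => /set2_eqP [] [tE hE].
  exists (-1); first by rewrite oppr_eq0 oner_eq0.
  by move=> y; rewrite /edge_form tE hE; ring.
exists 1; first exact: oner_neq0.
by move=> y; rewrite /edge_form tE hE; ring.
Qed.

End Directions.

(** * Triangles of R(T) *)

Section Triangles.
Variables (T : sgraph) (O : orientation T).
Let H := Rgraph T.

Definition base (e : edge T) : edge H :=
  @mk_edge H (inl (tail O e)) (inl (Defs.head O e)) (adj_ends O e).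

(** R(T) is the edge-disjoint union of one triangle per edge of [T]; the
    orientation [O] of [T] only serves to name the two ends of the edge. *)
Definition triangle (e : edge T) : seq (edge H) :=
  [:: base e;
      @mk_edge H (inl (tail O e)) (inr e) (incident_tail O e);
      @mk_edge H (inl (Defs.head O e)) (inr e) (incident_head O e)].

Definition triangles (es : seq (edge T)) : seq (edge H) :=
  flatten [seq triangle e | e <- es].

Lemma triangles_cons e es : triangles (e :: es) = triangle e ++ triangles es.
Proof. by []. Qed.

Lemma triangle_ends e (h : edge H) (w : H) : h \in triangle e -> incident w h ->
  match w with inl x => incident x e | inr f => f == e end.
Proof.
rewrite !inE => /or3P[]/eqP-> /set2P[]->;
  by rewrite ?incident_tail ?incident_head ?eqxx.
Qed.

Lemma incident_baseE e x : incident (inl x : H) (base e) = incident x e.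
Proof.
rewrite (incidentE _ (orientationP O e)).
exact: (incidentE (G := H) (e := base e) (inl x) erefl).
Qed.

Lemma base_newF e : incident (inr e : H) (base e) = false.
Proof. by apply/negbTE/negP => /set2P[]. Qed.

Lemma uniq_triangle e : uniq (triangle e).
Proof.
have th : tail O e != Defs.head O e := edge_neq (orientationP O e).
have neq (w : H) (h k : edge H) : incident w h -> ~~ incident w k -> h != k.
  by move=> wh; apply: contraNneq => <-.
rewrite /= !inE negb_or !andbT -andbA; apply/and3P; split.
- by rewrite eq_sym; apply: (neq (inr e)); rewrite ?base_newF // /incident set22.
- by rewrite eq_sym; apply: (neq (inr e)); rewrite ?base_newF // /incident set22.
- apply: (neq (inl (tail O e))); first by rewrite /incident set21.
  by apply/negP => /set2P[] // [] /eqP; rewrite (negPf th).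
Qed.

(** An edge through a new vertex belongs to the triangle of that vertex, and an
    original edge is determined by its two ends. *)
Lemma triangle_inj e f (h : edge H) :
  h \in triangle e -> h \in triangle f -> e = f.
Proof.
move=> he hf; have [eh|eh] := boolP (incident (inr e : H) h).
  by have /eqP := triangle_ends hf eh.
move: he; rewrite !inE => /or3P[]/eqP hE; last 2 first.
- by rewrite hE /incident /= set22 in eh.
- by rewrite hE /incident /= set22 in eh.
have tf : incident (tail O e) f.
  by apply: (triangle_ends (w := inl _) hf); rewrite hE incident_baseE incident_tail.
have hdf : incident (Defs.head O e) f.
  by apply: (triangle_ends (w := inl _) hf); rewrite hE incident_baseE incident_head.
apply: val_inj; rewrite (edge_set2 tf hdf) ?(orientationP O e) //.
exact: edge_neq (orientationP O e).
Qed.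

Lemma uniq_triangles es : uniq es -> uniq (triangles es).
Proof.
elim: es => [|e es IH] // /andP[ees /IH{}IH]; rewrite triangles_cons cat_uniq.
rewrite uniq_triangle IH andbT; apply/hasPn => h /flatten_mapP[f fes hf].
by apply: contra ees => he; rewrite (triangle_inj he hf).
Qed.

Lemma mem_triangles es (h : edge H) : (forall e, e \in es) -> h \in triangles es.
Proof.
move=> all_es.
suff [e he] : exists e, h \in triangle e by apply/flatten_mapP; exists e.
have eq_h (k : edge H) A : val h = A -> val k = A -> h == k.
  by move=> hE kE; apply/eqP/val_inj/(etrans hE).
have side x e : incident x e -> val h = [set inl x; inr e] -> h \in triangle e.
  rewrite (incidentE _ (orientationP O e)) !inE => /orP[]/eqP-> hE; apply/or3P.
    by apply: Or32; apply: (eq_h _ _ hE).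
  by apply: Or33; apply: (eq_h _ _ hE).
have [[x|e] [[y|f] [/= adj_h hE]]] := edge_ends h.
- exists (mk_edge adj_h); rewrite inE; apply/orP; left; apply: (eq_h _ _ hE).
  have /set2_eqP[] := orientationP O (mk_edge adj_h) => -[xE yE].
    by rewrite /= -xE -yE.
  by rewrite /= -xE -yE setUC.
- by exists f; apply: (side x f).
- by exists e; apply: (side y e) => //; rewrite setUC.
- by [].
Qed.

Definition covered (s : seq T) (es : seq (edge T)) (w : H) : bool :=
  match w with inl x => x \in s | inr e => e \in es end.

Lemma triangles_covered s es (h : edge H) w :
  growth s es -> h \in triangles es -> incident w h -> covered s es w.
Proof.
move=> gr /flatten_mapP[e ees he] /(triangle_ends he).
by case: w => [x|f] /=; [apply: growth_incident gr _ _ ees | move/eqP->].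
Qed.

Variables (R : numDomainType) (D : orientation H).

Lemma triangle_form e u v : val e = [set u; v] ->
  exists2 eps : R, eps != 0 & forall y : {ffun H -> R},
    \prod_(h <- triangle e) edge_form D h y =
    eps * ((y (inl v) - y (inl u)) * (y (inr e) - y (inl u)) *
           (y (inr e) - y (inl v))).
Proof.
move=> eE.
have [a a0 aE] := @edge_formE R H D (base e) _ _ erefl.
have [b b0 bE] := @edge_formE R H D
   (@mk_edge H (inl (tail O e)) (inr e) (incident_tail O e)) _ _ erefl.
have [c c0 cE] := @edge_formE R H D
   (@mk_edge H (inl (Defs.head O e)) (inr e) (incident_head O e)) _ _ erefl.
have abc : a * b * c != 0 by rewrite !mulf_neq0.
move: eE; rewrite (orientationP O) => /set2_eqP [] [tE hE].
  exists (- (a * b * c)); first by rewrite oppr_eq0.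
  by move=> y; rewrite !big_cons big_nil aE bE cE tE hE; ring.
exists (a * b * c) => //.
by move=> y; rewrite !big_cons big_nil aE bE cE tE hE; ring.
Qed.

(** [zs] collects, for each hung edge, the hung vertex, the new vertex of the
    edge and the edge itself.  Its elements contribute only to vertices reached
    so far, which makes the later leaves invisible to the earlier directions.
    The value [K] is independent of [y]; this is what carries the induction. *)
Lemma growth_difference s es : growth s es ->
  exists zs : seq (H + edge H),
  [/\ uniq zs, size zs = size (triangles es),
      forall z w, z \in zs -> contributes z w -> covered s es w &
      forall c : H + edge H -> R, (forall z, c z != 0) ->
      exists2 K, K != 0 & forall y,
        difference [seq step c z | z <- zs]
          (fun x => \prod_(h <- triangles es) edge_form D h x) y = K].
Proof.
elim=> [r|{}s {}es u v e gr [zs [uzs szs zs_cov zs_diff]] us vs eE].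
  exists [::]; split=> // c _; exists 1; first exact: oner_neq0.
  by move=> y /=; rewrite big_nil.
have ees : e \notin es.
  apply: contra vs => ees; apply: growth_incident gr _ _ ees _.
  by rewrite (incidentE _ eE) eqxx orbT.
have uv : u != v := edge_neq eE.
have base_v : incident (inl v : H) (base e).
  by rewrite incident_baseE (incidentE _ eE) eqxx orbT.
have base_u : incident (inl u : H) (base e).
  by rewrite incident_baseE (incidentE _ eE) eqxx.
have zs_v z : z \in zs -> ~~ contributes z (inl v).
  by move=> zzs; apply: contra vs => /(zs_cov _ _ zzs).
have zs_e z : z \in zs -> ~~ contributes z (inr e).
  by move=> zzs; apply: contra ees => /(zs_cov _ _ zzs).
pose z1 : H + edge H := inl (inl v); pose z2 : H + edge H := inl (inr e).
pose z3 : H + edge H := inr (base e).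
exists (zs ++ [:: z3; z2; z1]); split.
- have z1_zs : z1 \notin zs := contraTN (@zs_v z1) (eqxx _).
  have z2_zs : z2 \notin zs := contraTN (@zs_e z2) (eqxx _).
  have z3_zs : z3 \notin zs := contraTN (@zs_v z3) base_v.
  by rewrite cat_uniq uzs /= !negb_or z1_zs z2_zs z3_zs.
- by rewrite size_cat szs /= addn3.
- move=> z w; rewrite mem_cat => /orP[zzs /(zs_cov _ _ zzs)|].
    by case: w => [x|f] /=; rewrite inE => ->; rewrite orbT.
  rewrite !inE => /or3P[]/eqP->.
  - move=> bw; have := triangle_ends (mem_head _ _) bw.
    case: w {bw} => [x|f] /=; rewrite inE; last by move->.
    by rewrite (incidentE _ eE) => /orP[]/eqP->; rewrite ?us ?eqxx ?orbT.
  - by move/eqP <-; rewrite /= mem_head.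
  - by move/eqP <-; rewrite /= mem_head.
move=> c c0; have [K K0 KE] := zs_diff c c0.
have [eps eps0 epsE] := triangle_form eE.
exists (K * (eps * (- 2%:R * c z1 * c z2 * c z3))).
  by rewrite !mulf_neq0 // oppr_eq0 pnatr_eq0.
move=> y; rewrite map_cat.
pose P (x : {ffun H -> R}) := \prod_(h <- triangles es) edge_form D h x.
have P_inv (x d : {ffun H -> R}) : (forall w, covered s es w -> d w = 0) -> P (x + d) = P x.
  move=> d0; apply: eq_big_seq => h hes; rewrite edge_formD.
  rewrite [X in _ + X](_ : _ = 0) ?addr0 // /edge_form.
  rewrite !d0 ?subrr //; apply: (triangles_covered gr hes).
    exact: incident_tail.
  exact: incident_head.
have P1 x : P (x + step c z1) = P x.
  apply: P_inv => w cov; rewrite ffunE /=; case: eqVneq cov => // <- /=.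
  by rewrite (negPf vs).
have P2 x : P (x + step c z2) = P x.
  apply: P_inv => w cov; rewrite ffunE /=; case: eqVneq cov => // <- /=.
  by rewrite (negPf ees).
rewrite (@eq_difference _ _ _ _ (fun x => P x *
    (eps * ((x (inl v) - x (inl u)) * (x (inr e) - x (inl u)) *
            (x (inr e) - x (inl v)))))); last first.
  by move=> x; rewrite triangles_cons big_cat mulrC -epsE.
apply: (@difference_leaf _ _ P [seq step c z | z <- zs] K eps
  (inl u) (inl v) (inr e) (step c z1) (step c z2) (step c z3)).
- exact: KE.
- by move=> _ /mapP[z zzs ->]; rewrite !ffunE (negPf (zs_v _ zzs)) (negPf (zs_e _ zzs)).
- exact: P1.
- exact: P2.
- rewrite !ffunE /= eqxx (_ : (inl v == inl u) = false) //.
  by apply/eqP => -[vu]; rewrite vu eqxx in uv.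
- by rewrite !ffunE /= eqxx.
- by rewrite !ffunE /= base_u base_v base_newF.
Qed.

End Triangles.

(** * From differences to choosability and to the permanent index *)

Section Consequences.
Variables (R : realType) (H : sgraph) (D : orientation H).

Lemma weight_sumE (f : H + edge H -> R) v :
  weight_sum f v = \sum_z f z *+ contributes z v.
Proof.
rewrite big_sumType /= /weight_sum (bigD1 v) //= eqxx.
rewrite [\sum_(w | w != v) _]big1 ?addr0 => [|w /negPf -> //].
by congr (_ + _); rewrite big_mkcond; apply: eq_bigr => e _; case: ifP.
Qed.

(** Column [z] of the matrix lists the values of the edge forms on the unit
    step at [z].  For an edge [z] other than [h] this uses that [z] does not
    join both ends of [h]; for [z = h] the two ends cancel, as they should. *)
Lemma A_entryE (h : edge H) z : A_entry R D h z = edge_form D h (step (fun=> 1) z).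
Proof.
have th : tail D h != Defs.head D h := edge_neq (orientationP D h).
rewrite /edge_form !ffunE; case: z => [w|f] /=.
  have [->|wh] := eqVneq w (Defs.head D h).
    by rewrite eq_sym (negPf th) subr0.
  by case: eqVneq => _; rewrite /= ?mulr0n ?mulr1n ?sub0r ?subr0 ?oppr0.
have [->|fh] := eqVneq f h; first by rewrite incident_head incident_tail subrr.
have nboth : ~~ (incident (Defs.head D h) f && incident (tail D h) f).
  apply: contra fh => /andP[hf tf]; apply/eqP/val_inj.
  by rewrite (edge_set2 tf hf th) (orientationP D h).
move: nboth => /=; case: (incident _ f); case: (incident _ f) => //= _;
  by rewrite ?mulr0n ?mulr1n ?sub0r ?subr0 ?oppr0.
Qed.

Lemma weight_sum_toggle (x d : H + edge H -> R) (S : seq (H + edge H)) :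
  uniq S ->
  [ffun v => weight_sum (fun z => x z + d z *+ (z \in S)) v] =
  [ffun v => weight_sum x v] + \sum_(f <- [seq step d z | z <- S]) f.
Proof.
move=> uS; apply/ffunP=> v; rewrite !ffunE sum_ffunE big_map.
under [in RHS]eq_bigr => z _ do rewrite ffunE.
rewrite !weight_sumE (big_uniq _ uS) /= [X in _ = _ + X]big_mkcond -big_split /=.
apply: eq_bigr => z _; rewrite mulrnDl; congr (_ + _).
by case: (z \in S); rewrite ?mul0rn.
Qed.

(** A multilinear case of the Combinatorial Nullstellensatz: each [z] in [zs]
    starts at the first element of its list and steps to the second one, the
    other weights stay at the first element, and some combination of steps
    makes the product of the edge forms nonzero. *)
Lemma choosable_of_difference (zs : seq (H + edge H)) :
  uniq zs ->
  (forall (c : H + edge H -> R), (forall z, c z != 0) -> forall y,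
     difference [seq step c z | z <- zs] (fun x => \prod_h edge_form D h x) y != 0) ->
  choosable R H 2 2.
Proof.
move=> uzs diff_n0 L Lv Le.
have L2 z : size (L z : seq R) = 2 by case: z => [v|e]; [apply: Lv | apply: Le].
pose x z := (L z : seq R)`_0; pose d z := (L z : seq R)`_1 - x z.
have d0 z : d z != 0 by rewrite subr_eq0 nth_uniq ?L2 ?fset_uniq.
have [m] := difference_neq0 (diff_n0 d d0 [ffun v => weight_sum x v]).
rewrite -map_mask -weight_sum_toggle ?mask_uniq //.
pose f z := x z + d z *+ (z \in mask m zs).
rewrite -/f => /prodf_neq0 f_n0; exists f; split=> [u v uv|z].
  have := f_n0 (mk_edge uv) isT.
  have [eps _ ->] := @edge_formE R H D (mk_edge uv) _ _ erefl.
  rewrite !ffunE; apply: contraNnot => ->.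
  by rewrite subrr mulr0.
rewrite /f; case: (z \in _); rewrite ?mulr1n ?mulr0n ?addr0 /d ?[x z + _]addrC ?subrK;
  by rewrite mem_nth ?L2.
Qed.

Lemma pind1_of_difference (zs : seq (H + edge H)) :
  uniq zs -> size zs = #|edge H| ->
  difference [seq step (fun=> 1 : R) z | z <- zs]
    (fun x => \prod_h edge_form D h x) 0 != 0 ->
  pind_at_most (A_mx R D) 1.
Proof.
move=> uzs szs.
pose t := tcast szs (in_tuple zs).
have tE : [seq tnth t i | i <- enum 'I_#|edge H|] = zs.
  by rewrite map_tnth_enum val_tcast.
pose phi (i : 'I_#|edge H|) : 'I_#|{: H + edge H}| := enum_rank (tnth t i).
have phi_inj : injective phi.
  by move=> i j /enum_rank_inj; apply: tuple_uniqP; rewrite val_tcast.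
pose forms (y : {ffun H -> R}) : {ffun 'I_#|edge H| -> R} :=
  [ffun i => edge_form D (enum_val i) y].
have formsD : {morph forms : x y / x + y}.
  by move=> x y; apply/ffunP=> i; rewrite !ffunE edge_formD.
have forms0 : forms 0 = 0.
  by apply: (addrI (forms 0)); rewrite -formsD !addr0.
have -> : difference [seq step (fun=> 1 : R) z | z <- zs]
    (fun x => \prod_h edge_form D h x) 0 = per (colsub phi (A_mx R D)).
  rewrite /per -difference_prod_per -forms0.
  rewrite (_ : [seq _ | j <- _] = map forms [seq step (fun=> 1 : R) z | z <- zs]).
    rewrite difference_map //; apply: eq_difference => x /=.
    rewrite (reindex (@enum_val _ (edge H))) /=; last first.
      exact: onW_bij (@enum_val_bij _).
    by apply: eq_bigr => i _; rewrite ffunE.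
  rewrite -[in RHS]tE -!map_comp; apply: eq_map => j; apply/ffunP=> i /=.
  by rewrite !ffunE !mxE enum_rankK A_entryE.
move=> per_n0; exists phi; split=> // j.
apply/card_le1P => i; rewrite inE => /eqP <- k; rewrite !inE.
exact: inj_eq phi_inj k i.
Qed.

End Consequences.

Theorem corollary4p1 (R : realType) (T : sgraph) (hT : tree T) :
  (* the one-vertex tree has an empty matrix, for which the minimum is 0 *)
  ((1 < #|T|)%N ->
     forall D : orientation (Rgraph T), is_pind (A_mx R D) 1) /\
  choosable R (Rgraph T) 2 2.
Proof.
case: hT => connT acT.
have [O] := orientation_exists T.
have [s [es [gr all_s]]] := growth_exists connT.
have all_es f : f \in es by apply: (growth_complete acT gr).
have prodE (D : orientation (Rgraph T)) x :
    \prod_(h <- triangles O es) edge_form (R := R) D h x = \prod_h edge_form D h x.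
  rewrite -[RHS]big_enum; apply: perm_big; apply: uniq_perm.
  - exact: uniq_triangles (growth_uniq_edges gr).
  - exact: enum_uniq.
  - by move=> h; rewrite mem_enum mem_triangles.
have diffP (D : orientation (Rgraph T)) :
  exists zs : seq (Rgraph T + edge (Rgraph T)),
  [/\ uniq zs, size zs = #|edge (Rgraph T)| &
      forall c, (forall z, c z != 0) -> forall y,
        difference [seq step (R := R) c z | z <- zs]
          (fun x => \prod_h edge_form D h x) y != 0].
  have [zs [uzs szs _ zs_diff]] := growth_difference O R D gr.
  exists zs; split=> //.
    rewrite szs -(card_uniqP (uniq_triangles O (growth_uniq_edges gr))).
    by apply: eq_card => h; rewrite mem_triangles.
  move=> c /zs_diff[K K0 KE] y.
  by rewrite -(eq_difference _ _ (prodE D)) KE.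
split=> [T_gt1 D|]; last first.
  have [D] := orientation_exists (Rgraph T).
  have [zs [uzs _ zs_diff]] := diffP D.
  exact: choosable_of_difference uzs zs_diff.
have [zs [uzs szs zs_diff]] := diffP D; split.
  by apply: (pind1_of_difference uzs szs); apply: zs_diff => z; apply: oner_neq0.
move=> l [phi [_ phi_l]].
have E_gt0 : (0 < #|edge (Rgraph T)|)%N.
  have : (0 < size es)%N.
    rewrite -ltnS -(growth_size gr) -(card_uniqP (growth_uniq gr)).
    by rewrite (eq_card (B := T)) // => x; rewrite all_s.
  case: {+}es => // e es' _; apply/card_gt0P; by exists (base O e).
apply: leq_trans (phi_l (phi (Ordinal E_gt0))).
by rewrite card_gt0; apply/set0Pn; exists (Ordinal E_gt0); rewrite inE.
Qed.
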